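(* Let $n\ge 2$ and let $D$ be a connected digraph on $[n]$. The following are equivalent: (i) for every $\alpha\in\langle D\rangle$, $\ell(D,\alpha)=n-\mathrm{rk}(\alpha)$; (ii) $\langle D\rangle$ is a band, i.e. every $\alpha\in\langle D\rangle$ is idempotent; (iii) either $n=2$ and $D\cong K_2$, or there exists a bipartition $V_1\cup V_2$ of $[n]$ such that $(i_1,i_2)\in E(D)$ only if $i_1\in V_1$ and $i_2\in V_2$.
   Context: $[n]=\{1,\dots,n\}$. A digraph has no loops and no multiple edges (both $(a,b)$ and $(b,a)$ may be edges); ''on $[n]$'' means its vertex set is $[n]$. $D$ is connected if its underlying undirected graph is connected. For distinct $a,b\in[n]$, $(a\to b)$ is the transformation of $[n]$ sending $a$ to $b$ and fixing every other point; maps act on the right and products are composed from left to right. $\langle D\rangle$ is the semigroup generated by $\{(a\to b):(a,b)\in E(D)\}$. For $\alpha\in\langle D\rangle$, $\ell(D,\alpha)$ is the minimum length of a word in the generators $(a\to b)$, $(a,b)\in E(D)$, whose product is $\alpha$. $\mathrm{rk}(\alpha)$ is the size of the image of $\alpha$. $K_2$ is the complete undirected graph on two vertices, i.e. the digraph with both edges $(1,2)$ and $(2,1)$. *)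

(* Defs.v *)
From mathcomp Require Import all_boot.

Set Implicit Arguments.
Unset Strict Implicit.
Unset Printing Implicit Defensive.

Record digraph (T : finType) := Digraph {
  arc :> rel T;
  arc_irr : irreflexive arc
}.

Definition connected (T : finType) (D : digraph T) : Prop :=
  forall x y : T, connect (fun a b => D a b || D b a) x y.

Definition digraph_iso (T U : finType) (D : digraph T) (E : digraph U) : Prop :=
  exists2 f : T -> U, bijective f & forall x y, E (f x) (f y) = D x y.

Lemma complete_irr (n : nat) : irreflexive (fun x y : 'I_n => x != y).
Proof. by move=> x; rewrite eqxx. Qed.

Definition complete_digraph (n : nat) : digraph 'I_n :=
  Digraph (@complete_irr n).

Section Transformations.
Variable T : finType.

Definition transf := {ffun T -> T}.

Definition idt : transf := [ffun x => x].

(* Maps act on the right: x (f g) = (x f) g. *)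
Definition mult (f g : transf) : transf := [ffun x => g (f x)].

Definition arc_map (a b : T) : transf := [ffun x => if x == a then b else x].

Definition rk (f : transf) : nat := #|f @: [set: T]|.

Definition idempotent_transf (f : transf) : Prop := mult f f = f.

(* The letter (a, b) stands for (a -> b). *)
Definition eval_word (w : seq (T * T)) : transf :=
  foldl (fun f e => mult f (arc_map e.1 e.2)) idt w.

Variable D : digraph T.

Definition expresses (f : transf) (w : seq (T * T)) : bool :=
  [&& w != [::], all (fun e => D e.1 e.2) w & eval_word w == f].

(* Semigroup, not monoid: the empty word is excluded by [expresses]. *)
Definition in_semigroup (f : transf) : Prop := exists w, expresses f w.

Definition expressible_in (f : transf) (k : nat) : bool :=
  [exists w : k.-tuple (T * T), expresses f w].

Lemma in_semigroup_expressible (f : transf) :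
  in_semigroup f -> exists k, expressible_in f k.
Proof.
by case=> w fw; exists (size w); apply/existsP; exists (in_tuple w).
Qed.

Definition word_length (f : transf) (fD : in_semigroup f) : nat :=
  ex_minn (in_semigroup_expressible fD).

Definition band : Prop := forall f, in_semigroup f -> idempotent_transf f.

End Transformations.

(* A part may be empty, as usual for bipartitions of graphs; any arc of D
   forces both parts to be nonempty. *)
Definition directed_bipartition (T : finType) (D : digraph T)
    (V1 V2 : {set T}) : Prop :=
  [/\ V1 :|: V2 = [set: T], [disjoint V1 & V2]
    & forall x y, D x y -> x \in V1 /\ y \in V2].

(* Main.v *)
Require Import Defs.
From mathcomp Require Import all_boot.

Set Implicit Arguments.
Unset Strict Implicit.
Unset Printing Implicit Defensive.

(** Every letter of a word lowers the rank by at most one, so an element [f] of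
    the semigroup of [D] never has length below [n - rk f]
    ([rank_defect_le_size]). If [f] is idempotent, its image is its set of fixed
    points, and [n - rk f] is the number of points that [f] moves. If moreover
    every moved [x] has an arc to [f x], the letters [(x, f x)], [x] moved, can
    be composed in any order: the targets are fixed points, so no letter
    disturbs another, and the product is [f]. The lower bound is then attained
    ([word_length_along_arcs]). So all three conditions hold as soon as the
    elements of the semigroup are idempotents that move points along arcs.

    That happens when no two arcs are consecutive, since a point that has moved
    once then sits on a sink forever, and also on two points joined both ways,
    where a nonempty product of letters is constant.

    In the other direction, the obstruction is a directed path [a -> b -> c] with
    [a <> c]: the product of [(b -> c)] and [(a -> b)], in this order, sends [a]
    to [b] and [b] to [c]. It is not idempotent, and it has rank [n - 1] without
    being a single letter, so its existence refutes both the length formula and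
    the band property. When there is no such path, either no two arcs are
    consecutive, which is a directed bipartition (vertices with an outgoing arc
    against the others), or there is a 2-cycle [a -> b -> a]; an arc between
    this cycle and a third vertex would create an obstruction, so connectedness
    leaves only the two vertices [a] and [b]. *)

(** * Words, rank and idempotents *)

Section Words.
Variable T : finType.
Implicit Types (f g : transf T) (w : seq (T * T)).

Lemma eval_word_rcons w e :
  eval_word (rcons w e) = mult (eval_word w) (arc_map e.1 e.2).
Proof. by rewrite /eval_word -cats1 foldl_cat. Qed.

(** Composition of maps grows a word at its end; following a single point
    instead gives inductions from the first letter ([eval_word_cons]). *)
Lemma eval_wordE w x :
  eval_word w x = foldl (fun y e => arc_map e.1 e.2 y) x w.
Proof.
elim/last_ind: w => [|w e IHw]; first by rewrite /eval_word /= ffunE.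
by rewrite eval_word_rcons ffunE IHw -cats1 foldl_cat.
Qed.

Lemma eval_word_nil (x : T) : eval_word [::] x = x.
Proof. by rewrite eval_wordE. Qed.

Lemma eval_word_cons e w x :
  eval_word (e :: w) x = eval_word w (if x == e.1 then e.2 else x).
Proof. by rewrite !eval_wordE /= ffunE. Qed.

Lemma eval_word1 (a b : T) : eval_word [:: (a, b)] = arc_map a b.
Proof. by apply/ffunP=> x; rewrite eval_word_cons eval_word_nil ffunE. Qed.

Lemma arc_map_idem (a b : T) : idempotent_transf (arc_map a b).
Proof. by apply/ffunP=> x; rewrite !ffunE; do 2 case: eqP. Qed.

Lemma rk_idt : rk (idt T) = #|T|.
Proof.
by rewrite /rk card_imset ?cardsT // => x y; rewrite !ffunE.
Qed.

(** The only image point that a letter [(a -> b)] can destroy is [a]. *)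
Lemma rk_mult_arc_map f a b : rk f <= (rk (mult f (arc_map a b))).+1.
Proof.
rewrite /rk; set B := [set mult f (arc_map a b) x | x in _].
have sub : f @: [set: T] \subset a |: B.
  apply/subsetP=> _ /imsetP[x _ ->]; rewrite in_setU1.
  case: (eqVneq (f x) a) => //= fxa.
  by apply/imsetP; exists x; rewrite ?inE // !ffunE (negPf fxa).
by apply: leq_trans (subset_leq_card sub) _; rewrite cardsU1; case: (a \notin B).
Qed.

Lemma rank_defect_le_size w : #|T| - rk (eval_word w) <= size w.
Proof.
rewrite leq_subLR; elim/last_ind: w => [|w e IHw].
  by rewrite /eval_word /= rk_idt addn0.
rewrite eval_word_rcons size_rcons addnS -addSn.
by apply: leq_trans IHw _; rewrite leq_add2r rk_mult_arc_map.
Qed.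

Definition moved f : {set T} := [set x | f x != x].

Lemma idempotentP f : idempotent_transf f <-> forall x, f (f x) = f x.
Proof.
split=> [ff x | ff]; first by rewrite -[in RHS]ff ffunE.
by apply/ffunP=> x; rewrite ffunE.
Qed.

(** The image of an idempotent is its set of fixed points. *)
Lemma rank_defect_idempotent f :
  idempotent_transf f -> #|T| - rk f = #|moved f|.
Proof.
move/idempotentP=> ff; rewrite -cardsT.
have -> : rk f = #|~: moved f|.
  congr #|pred_of_set _|; apply/setP=> y; rewrite !inE negbK.
  apply/imsetP/eqP=> [[x _ ->] | fy]; first exact: ff.
  by exists y; rewrite ?inE.
by rewrite cardsT -[#|T|](cardsC (moved f)) addnK.
Qed.

Definition moved_word f := [seq (x, f x) | x <- enum (moved f)].

Lemma eval_moved_word f : idempotent_transf f -> eval_word (moved_word f) = f.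
Proof.
move/idempotentP=> ff; apply/ffunP=> x.
(* Values of [f] are fixed points, hence never the source of a letter. *)
have eval_sub s y : {subset s <= moved f} ->
    eval_word [seq (z, f z) | z <- s] y = if y \in s then f y else y.
  elim: s y => [|z s IHs] y sub; first by rewrite eval_word_nil.
  have sub' : {subset s <= moved f} by move=> t ts; rewrite sub // inE ts orbT.
  rewrite /= eval_word_cons inE IHs //=.
  case: eqP => [-> | _] //=; rewrite ff.
  by case: ifP.
rewrite eval_sub => [|y]; last by rewrite mem_enum.
by rewrite mem_enum inE; case: eqP => [->|].
Qed.

End Words.

(** * Length in the semigroup of a digraph *)

Section Lengths.
Variables (T : finType) (D : digraph T).
Implicit Types f : transf T.

Lemma arc_neq a b : D a b -> a != b.
Proof. by apply: contraTneq => ->; rewrite arc_irr. Qed.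

Lemma word_length_expresses f (fD : in_semigroup D f) :
  exists2 w, expresses D f w & size w = word_length fD.
Proof.
rewrite /word_length; case: ex_minnP => k /existsP[w fw] _.
by exists w; rewrite ?size_tuple.
Qed.

Lemma word_length_le f (fD : in_semigroup D f) w :
  expresses D f w -> word_length fD <= size w.
Proof.
rewrite /word_length => fw; case: ex_minnP => k _; apply.
by apply/existsP; exists (in_tuple w).
Qed.

(** The first letter of a nonempty word already identifies its two ends. *)
Lemma in_semigroup_merges_arc f :
  in_semigroup D f -> exists a b, D a b /\ f a = f b.
Proof.
case=> [[//|[a b] w]] /and3P[_ /= /andP[Dab _] /eqP<-].
by exists a, b; split; rewrite // !eval_word_cons /= eqxx; case: ifP.
Qed.

Definition along_arcs f := forall x, f x != x -> D x (f x).

(** The words of moved points attain the lower bound given by the rank. Since [f]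
    merges the ends of an arc it is not the identity, so that this word is not
    the excluded empty one. *)
Lemma word_length_along_arcs f (fD : in_semigroup D f) :
  idempotent_transf f -> along_arcs f -> word_length fD = #|T| - rk f.
Proof.
move=> ff fA; apply/eqP; rewrite eqn_leq; apply/andP; split; last first.
  have [w /and3P[_ _ /eqP Ef] <-] := word_length_expresses fD.
  by rewrite -Ef rank_defect_le_size.
rewrite rank_defect_idempotent // [X in _ <= X]cardE -(size_map (fun x => (x, f x))).
apply: word_length_le; apply/and3P; split; last by rewrite eval_moved_word.
- have [a [b [Dab fab]]] := in_semigroup_merges_arc fD.
  apply: contraTneq (arc_neq Dab) => w0; rewrite negbK.
  have fE x : f x = x by rewrite -[in LHS](eval_moved_word ff) /moved_word w0 eval_word_nil.
  by rewrite -(fE a) fab fE.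
- by apply/allP=> _ /mapP[x + ->]; rewrite mem_enum inE; apply: fA.
Qed.

Definition along_arcs_band :=
  forall f, in_semigroup D f -> idempotent_transf f /\ along_arcs f.

(** * Digraphs whose semigroup consists of idempotents along arcs *)

Definition no_consecutive_arcs := forall a b c, D a b -> ~~ D b c.

Lemma eval_word_sink w x : all (fun e => D e.1 e.2) w ->
  (forall y, ~~ D x y) -> eval_word w x = x.
Proof.
move=> + xS; elim: w => [|e w IHw] /=; first by rewrite eval_word_nil.
case/andP=> De Dw; rewrite eval_word_cons ifN ?IHw //.
by apply: contraTneq De => <-; apply: xS.
Qed.

(** A point moves at most once, because the end of an arc is then a sink. *)
Lemma no_consecutive_along_arcs : no_consecutive_arcs -> along_arcs_band.
Proof.
move=> D2 f [w /and3P[_ Dw /eqP Ef]].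
have fA : along_arcs f.
  rewrite -{}Ef => x; elim: w Dw => [|e w IHw] /=.
    by rewrite eval_word_nil eqxx.
  case/andP=> De Dw; rewrite eval_word_cons; case: (x =P e.1) => [-> _ | _]; last exact: IHw.
  by rewrite eval_word_sink // => y; apply: D2 De.
split=> //; apply/idempotentP=> x.
case: (eqVneq (f x) x) => [fx | /fA Dx]; first by rewrite !fx.
by rewrite -{1}Ef eval_word_sink // => y; apply: D2 Dx.
Qed.

Lemma card2_cases (a b x : T) : #|T| = 2 -> a != b -> x = a \/ x = b.
Proof.
move=> T2 ab.
have abT : [set a; b] == [set: T] by rewrite eqEcard subsetT cardsT T2 cards2 ab.
by have := in_setT x; rewrite -(eqP abT) => /set2P.
Qed.

(** On two points, a map that merges the ends of an arc is constant. *)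
Lemma complete2_along_arcs :
  #|T| = 2 -> (forall x y, D x y = (x != y)) -> along_arcs_band.
Proof.
move=> T2 DE f fD; split; last by move=> x fx; rewrite DE eq_sym.
have [a [b [/arc_neq ab fab]]] := in_semigroup_merges_arc fD.
have fE x : f x = f a by case: (card2_cases x T2 ab) => ->.
by apply/idempotentP=> x; rewrite fE [RHS]fE.
Qed.

(** * Obstruction by directed paths of length two *)

Definition only_return_paths := forall a b c, D a b -> D b c -> a = c.

(** The product of [(b -> c)] and [(a -> b)] sends [a] to [b] and [b] to [c], so
    it is idempotent only if [a = c]. *)
Lemma path_product_not_idempotent a b c : D a b -> D b c ->
  idempotent_transf (eval_word [:: (b, c); (a, b)]) -> a = c.
Proof.
move=> /arc_neq ab /arc_neq bc /idempotentP /(_ a).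
rewrite !eval_word_cons !eval_word_nil /= (negPf ab) !eqxx.
by case: eqP => [-> // | _] cb; rewrite cb eqxx in bc.
Qed.

Lemma path_product_in_semigroup a b c : D a b -> D b c ->
  in_semigroup D (eval_word [:: (b, c); (a, b)]).
Proof.
by move=> Dab Dbc; exists [:: (b, c); (a, b)]; rewrite /expresses /= Dab Dbc eqxx.
Qed.

Lemma band_only_return_paths : band D -> only_return_paths.
Proof.
move=> bD a b c Dab Dbc; apply: (path_product_not_idempotent Dab Dbc).
exact/bD/path_product_in_semigroup.
Qed.

(** If [a] and [c] differ, the product of [(b -> c)] and [(a -> b)] misses only
    the point [a]; the length formula would make it a single letter, hence
    idempotent. *)
Lemma length_only_return_paths :
  (forall f (fD : in_semigroup D f), word_length fD = #|T| - rk f) ->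
  only_return_paths.
Proof.
move=> lenD a b c Dab Dbc; apply/eqP; apply: contraT => ac.
have fD := path_product_in_semigroup Dab Dbc.
have ab := arc_neq Dab.
set f := eval_word _ in fD.
have rkf : #|T| - rk f <= 1.
  rewrite leq_subLR addnC -cardsT (cardsD1 a) inE leq_add2l.
  apply: subset_leq_card; apply/subsetP=> y.
  rewrite !inE andbT => ya; apply/imsetP.
  (* [b] is the image of [a], and every point other than [a] and [b] is fixed. *)
  exists (if y == b then a else y) => //; rewrite /f !eval_word_cons eval_word_nil /=.
  case: (eqVneq y b) => [-> | yb]; first by rewrite (negPf ab) eqxx.
  by rewrite (negPf yb) (negPf ya).
have [w fw sw] := word_length_expresses fD.
rewrite -(lenD f fD) -sw in rkf.
case/and3P: fw rkf; case: w {sw} => [//|[x y] [|//]] _ _ /eqP Ef _.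
have ff : idempotent_transf f by rewrite -Ef eval_word1; apply: arc_map_idem.
by rewrite (path_product_not_idempotent Dab Dbc ff) eqxx in ac.
Qed.

(** * Shape of the digraphs without obstruction *)

(** A vertex adjacent to a 2-cycle is the end of a path through it, which has to
    return: a 2-cycle absorbs its whole component. *)
Lemma two_cycle_spans a b : connected D -> only_return_paths ->
  D a b -> D b a -> forall x, x \in [set a; b].
Proof.
move=> cD D2 Dab Dba x.
have esym : symmetric (fun u v => D u v || D v u) by move=> u v; rewrite orbC.
have clos : closed (fun u v => D u v || D v u) [set a; b].
  apply: (intro_closed (sym_connect_sym esym)) => u v Duv /set2P[] Eu;
    rewrite {u}Eu in Duv; case/orP: Duv => Duv; apply/set2P.
  - by right; rewrite (D2 _ _ _ Dba Duv).
  - by right; rewrite (D2 _ _ _ Duv Dab).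
  - by left; rewrite (D2 _ _ _ Dab Duv).
  - by left; rewrite (D2 _ _ _ Duv Dba).
by rewrite -(closed_connect clos (cD a x)) set21.
Qed.

Lemma only_return_paths_dichotomy : connected D -> only_return_paths ->
  (#|T| = 2 /\ forall x y, D x y = (x != y)) \/ no_consecutive_arcs.
Proof.
move=> cD D2.
case: (boolP [exists a, exists b, D a b && D b a]) => [|no2].
  case/existsP=> a /existsP[b /andP[Dab Dba]]; left.
  have abT := two_cycle_spans cD D2 Dab Dba.
  have ab := arc_neq Dab.
  split.
    rewrite -cardsT; have -> : [set: T] = [set a; b].
      by apply/setP=> x; rewrite abT inE.
    by rewrite cards2 ab.
  move=> x y; case/set2P: (abT x) => ->; case/set2P: (abT y) => ->;
    by rewrite ?arc_irr ?eqxx // ?Dab ?Dba // ?ab // eq_sym ab.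
right=> a b c Dab; apply: contra no2 => Dbc.
by apply/existsP; exists a; apply/existsP; exists b; rewrite Dab (D2 _ _ _ Dab Dbc).
Qed.

Lemma directed_bipartitionP :
  no_consecutive_arcs <-> exists V1 V2 : {set T}, directed_bipartition D V1 V2.
Proof.
split=> [D2 | [V1 [V2 [_ dis DV]]] a b c /DV[_ b2]].
  pose V1 := [set x | [exists y, D x y]].
  exists V1, (~: V1); split=> [||x y Dxy]; first exact: setUCr.
    by rewrite disjoints_subset setCK.
  split; rewrite !inE; first by apply/existsP; exists y.
  by apply/existsPn=> z; apply: D2 Dxy.
by apply/negP=> /DV[b1 _]; rewrite (disjointFr dis b1) in b2.
Qed.

End Lengths.

Lemma complete2P (n : nat) (D : digraph 'I_n) :
  (#|'I_n| = 2 /\ forall x y, D x y = (x != y)) <->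
  (n = 2 /\ digraph_iso D (complete_digraph 2)).
Proof.
rewrite card_ord; split=> [] [n2]; subst n.
  by move=> DE; split=> //; exists id => [|x y]; [exists id | rewrite DE].
by case=> f /bij_inj injf fE; split=> // x y; rewrite -fE /= (inj_eq injf).
Qed.

Theorem theorem2p12 (n : nat) (hn : 2 <= n) (D : digraph 'I_n)
    (hD : connected D) :
  ((forall (f : transf 'I_n) (fD : in_semigroup D f),
      word_length fD = n - rk f)
    <-> band D) /\
  (band D <->
    ((n = 2 /\ digraph_iso D (complete_digraph 2)) \/
     exists V1 V2 : {set 'I_n}, directed_bipartition D V1 V2)).
Proof.
have shape_along : ((n = 2 /\ digraph_iso D (complete_digraph 2)) \/
     exists V1 V2 : {set 'I_n}, directed_bipartition D V1 V2) ->
    along_arcs_band D.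
  case=> [/complete2P[] | /directed_bipartitionP].
    exact: complete2_along_arcs.
  exact: no_consecutive_along_arcs.
have paths_shape : only_return_paths D ->
    (n = 2 /\ digraph_iso D (complete_digraph 2)) \/
     exists V1 V2 : {set 'I_n}, directed_bipartition D V1 V2.
  case/(only_return_paths_dichotomy hD) => [/complete2P | /directed_bipartitionP].
    by left.
  by right.
have band_paths := @band_only_return_paths _ D.
split; split.
- move=> lenD f fD; apply: (proj1 (shape_along (paths_shape _) f fD)).
  by apply: length_only_return_paths => g gD; rewrite card_ord.
- move=> bD f fD; have [ff fA] := shape_along (paths_shape (band_paths bD)) f fD.
  by rewrite (word_length_along_arcs fD ff fA) card_ord.
- by move/band_paths/paths_shape.
- by move=> shape f fD; apply: (proj1 (shape_along shape f fD)).
Qed.
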